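(* Let $s\in\{+,-\}$, let $x,z\in\mathbb{C}$ satisfy $x^2+z^2-z=0$ if $s=+$ and $x^2+z^2+z=0$ if $s=-$, let $\overline{P}\in1\oplus\mathcal{P}_3$, and let $A$ be any one of the matrices $$\overline{P}M^{s}_{x,z},\ \ \overline{P}N^{s}_{z,x},\ \ \overline{P}P_{(23)}M^{s}_{x,z}P_{(23)},\ \ \overline{P}P_{(23)}N^{s}_{z,x}P_{(23)},\ \ \overline{P}P_{(24)}M^{s}_{x,z}P_{(24)},\ \ \overline{P}P_{(24)}N^{s}_{z,x}P_{(24)}.$$ Then $A$ is a rational orthogonal permutative matrix (all entries in $\mathbb{Q}$) if and only if - in the case $s=+$: $x=\dfrac{r^2-1}{2(r^2+1)}$ and $z=\dfrac12\pm\dfrac{r}{r^2+1}$, where $r\in\mathbb{Q}$; - in the case $s=-$: $x=\dfrac{r^2-1}{2(r^2+1)}$ and $z=-\dfrac12\pm\dfrac{r}{r^2+1}$, where $r\in\mathbb{Q}$.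
   Context: $\mathcal{P}_n$ is the group of $n\times n$ permutation matrices; for a permutation $\sigma$, $P_\sigma$ has $(i,j)$ entry $1$ if $\sigma(i)=j$ and $0$ otherwise. $1\oplus\mathcal{P}_3=\left\{\begin{bmatrix}1&\mathbf{0}^T\\ \mathbf{0}&P\end{bmatrix}: P\in\mathcal{P}_3\right\}$. A matrix is permutative if each of its rows is a permutation of any other row; it is orthogonal if $A^TA=I$. For complex $t,x,z$ and a sign $\pm$: $$A_t=\begin{bmatrix}t&-t\\-t&t\end{bmatrix},\quad B^{\pm}_t=\begin{bmatrix}t&\pm1-t\\ \pm1-t&t\end{bmatrix},\quad F=\begin{bmatrix}0&1\\1&0\end{bmatrix},$$ $$M^{\pm}_{x,z}=\begin{bmatrix}A_x&B^{\pm}_z\\ B^{\pm}_z&-A_x\end{bmatrix},\quad N^{\pm}_{z,x}=\begin{bmatrix}B^{\pm}_z&A_x\\ A_x&FB^{\pm}_z\end{bmatrix}.$$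
   Formalization: The formal theorem adds to the right-hand side the one point missed by rational r (r = ∞): x = 1/2, z = 1/2 for s = + and x = 1/2, z = −1/2 for s = −, where A is rational orthogonal permutative but no r ∈ ℚ exists. *)

(* Defs.v *)
From HB Require Import structures.
From mathcomp Require Export all_boot all_order all_algebra all_fingroup.
From mathcomp Require Export reals complex.

Set Implicit Arguments.
Unset Strict Implicit.
Unset Printing Implicit Defensive.

Import Order.TTheory GRing.Theory Num.Theory.
Local Open Scope ring_scope.

Definition permutative (K : Type) (n : nat) (A : 'M[K]_n) : Prop :=
  forall i k : 'I_n, exists s : 'S_n, row k A = col_perm s (row i A).

Definition orthogonal_mx (K : pzRingType) (n : nat) (A : 'M[K]_n) : Prop :=
  A^T *m A = 1%:M.

Definition rational_mx (K : unitRingType) (n : nat) (A : 'M[K]_n) : Prop :=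
  forall i j : 'I_n, exists q : rat, A i j = ratr q.

Inductive sign : Set := Plus | Minus.

Section Families.
Variable K : pzRingType.

Definition signr (s : sign) : K := if s is Plus then 1 else - 1.

Definition mx2 (a b c d : K) : 'M[K]_2 :=
  block_mx (a%:M : 'M_1) (b%:M : 'M_1) (c%:M : 'M_1) (d%:M : 'M_1).

Definition mxA (t : K) : 'M[K]_2 := mx2 t (- t) (- t) t.

Definition mxB (s : sign) (t : K) : 'M[K]_2 :=
  mx2 t (signr s - t) (signr s - t) t.

Definition mxF : 'M[K]_2 := mx2 0 1 1 0.

Definition mxM (s : sign) (x z : K) : 'M[K]_4 :=
  block_mx (mxA x) (mxB s z) (mxB s z) (- mxA x).

Definition mxN (s : sign) (z x : K) : 'M[K]_4 :=
  block_mx (mxB s z) (mxA x) (mxA x) (mxF *m mxB s z).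

Definition in_one_oplus_P3 (Q : 'M[K]_4) : Prop :=
  exists2 P : 'M[K]_3, is_perm_mx P & Q = block_mx (1%:M : 'M_1) 0 0 P.

(* Ordinals count from 0, so the transpositions (23) and (24) of {1,2,3,4}
   exchange the indices 1, 2 and 1, 3 of 'I_4. *)
Definition P23 : 'M[K]_4 :=
  perm_mx (tperm (Ordinal (isT : 1 < 4)%N) (Ordinal (isT : 2 < 4)%N)).

Definition P24 : 'M[K]_4 :=
  perm_mx (tperm (Ordinal (isT : 1 < 4)%N) (Ordinal (isT : 3 < 4)%N)).

End Families.

Arguments P23 {K}.
Arguments P24 {K}.

(* Main.v *)
(* All six families are obtained from [mxM s x z] by permuting rows and columns
   (in particular N = P_(34) M P_((13)(24))), and such permutations preserve all
   three properties. Orthogonality and permutativity of M hold as soon as (x, z)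
   lies on the given circle, so the claim reduces to parametrizing the rational
   points of that circle. *)

Require Import Defs.
From mathcomp Require Import ring lra zify.

Import Order.TTheory GRing.Theory Num.Theory.
Local Open Scope ring_scope.
Local Open Scope complex_scope.

(** * Row and column permutations of a matrix *)

Section PermutationMatrices.
Variables (n : nat).
Implicit Types u v : 'S_n.

Lemma perm_mx_orthogonal (K : pzRingType) u : orthogonal_mx (perm_mx u : 'M[K]_n).
Proof. by rewrite /orthogonal_mx tr_perm_mx -perm_mxM mulVg perm_mx1. Qed.

Lemma orthogonal_mxM (K : comPzRingType) (A B : 'M[K]_n) :
  orthogonal_mx A -> orthogonal_mx B -> orthogonal_mx (A *m B).
Proof.
rewrite /orthogonal_mx => oA oB.
by rewrite trmx_mul mulmxA -(mulmxA B^T) oA mulmx1.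
Qed.

Lemma mul_perm_mxE (K : pzRingType) u v (A : 'M[K]_n) i j :
  (perm_mx u *m A *m perm_mx v) i j = A (u i) ((v^-1)%g j).
Proof. by rewrite -{1}(invgK v) -col_permE -row_permE !mxE. Qed.

Lemma rational_perm_mx (K : unitRingType) u v (A : 'M[K]_n) :
  rational_mx (perm_mx u *m A *m perm_mx v) <-> rational_mx A.
Proof.
split=> ratA i j; last by rewrite mul_perm_mxE.
by have := ratA ((u^-1)%g i) (v j); rewrite mul_perm_mxE permKV permK.
Qed.

Lemma permutative_perm_mx (K : pzRingType) u v (A : 'M[K]_n) :
  permutative A -> permutative (perm_mx u *m A *m perm_mx v).
Proof.
move=> permA i k; have [s /rowP rowA] := permA (u i) (u k).
(* Column [j] of the product is column [v^-1 j] of [A], so the permutation relating rows [u i] and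
   [u k] of [A] gets conjugated by [v]. *)
exists (v^-1 * s * v)%g; apply/rowP=> j; have := rowA ((v^-1)%g j).
by rewrite !(mxE, mul_perm_mxE) !permM permK.
Qed.

(** Reduces the search for a column permutation to a comparison of multisets of entries;
    [tuple_permP] supplies the permutation. *)
Lemma permutative_perm_eq (K : eqType) (A : 'M[K]_n) :
  (forall i k, perm_eq [seq A k j | j : 'I_n] [seq A i j | j : 'I_n]) ->
  permutative A.
Proof.
move=> permA i k; have := permA i k.
rewrite -[X in perm_eq X _]/(tval [tuple A k j | j < n]).
rewrite -[X in perm_eq _ X]/(tval [tuple A i j | j < n]).
case/tuple_permP=> s eqA; exists s; apply/rowP=> j; rewrite !mxE.
have /(congr1 (fun t => tnth t j)) := val_inj eqA.
by rewrite !tnth_mktuple.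
Qed.

End PermutationMatrices.

(** * The matrices M and N by entries *)

Section Families.
Variables (K : comNzRingType) (s : sign).
Implicit Types x z : K.

(** A literal list of rows lets entries at concrete indices be found by computation. The defaults
    [0] and [[::]] are never reached on a full 4 by 4 list. *)
Definition mx4 (ll : seq (seq K)) : 'M[K]_4 :=
  \matrix_(i, j) nth 0 (nth [::] ll i) j.

Lemma mx2E (a b c d : K) i j :
  mx2 a b c d i j = nth 0 (nth [::] [:: [:: a; b]; [:: c; d]] i) j.
Proof.
rewrite /mx2; case: (@split_ordP 1 1 i) => {}i ->;
  case: (@split_ordP 1 1 j) => {}j ->;
  rewrite ?(@block_mxEul _ 1 1 1 1) ?(@block_mxEur _ 1 1 1 1)
          ?(@block_mxEdl _ 1 1 1 1) ?(@block_mxEdr _ 1 1 1 1);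
  by rewrite !ord1 mxE.
Qed.

Lemma mx2_block4 (a b c d a1 b1 c1 d1 a2 b2 c2 d2 a3 b3 c3 d3 : K) :
  block_mx (mx2 a b c d) (mx2 a1 b1 c1 d1) (mx2 a2 b2 c2 d2) (mx2 a3 b3 c3 d3)
  = mx4 [:: [:: a; b; a1; b1]; [:: c; d; c1; d1];
            [:: a2; b2; a3; b3]; [:: c2; d2; c3; d3]].
Proof.
apply/matrixP=> i j; rewrite [RHS]mxE.
case: (@split_ordP 2 2 i) => {}i ->; case: (@split_ordP 2 2 j) => {}j ->;
  rewrite ?block_mxEul ?block_mxEur ?block_mxEdl ?block_mxEdr;
  rewrite mx2E; move: i j => [[|[|i]] //= hi] [[|[|j]] //= hj].
Qed.

Lemma mxM_mx4 x z : mxM s x z =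
  let w := signr K s - z in
  mx4 [:: [:: x; - x; z; w]; [:: - x; x; w; z];
          [:: z; w; - x; x]; [:: w; z; x; - x]].
Proof.
have opp2 : - mxA x = mx2 (- x) x x (- x).
  apply/matrixP=> i j; rewrite mxE !mx2E.
  by move: i j => [[|[|i]] //= hi] [[|[|j]] //= hj]; rewrite ?opprK.
by rewrite /mxM opp2 mx2_block4.
Qed.

Lemma mxN_mx4 x z : mxN s z x =
  let w := signr K s - z in
  mx4 [:: [:: z; w; x; - x]; [:: w; z; - x; x];
          [:: x; - x; w; z]; [:: - x; x; z; w]].
Proof.
have mulF2 : mxF K *m mxB s z = mx2 (signr K s - z) z z (signr K s - z).
  apply/matrixP=> i j; rewrite mxE !big_ord_recl big_ord0 !mx2E.
  by move: i j => [[|[|i]] //= hi] [[|[|j]] //= hj];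
    rewrite !(mul0r, mul1r, add0r, addr0).
by rewrite /mxN mulF2 mx2_block4.
Qed.

Lemma mxN_mxM x z :
  exists u v : 'S_4, mxN s z x = perm_mx u *m mxM s x z *m perm_mx v.
Proof.
pose o k : 'I_4 := inord k.
(* Counting from 0: the first swaps the last two rows, the second exchanges the left and right
   halves of the columns. *)
exists (tperm (o 2%N) (o 3%N)), (tperm (o 0%N) (o 2%N) * tperm (o 1%N) (o 3%N))%g.
apply/matrixP=> i j; rewrite mul_perm_mxE invMg !tpermV permM mxM_mx4 mxN_mx4.
rewrite !mxE /=.
case: i j => [[|[|[|[|i]]]] //= hi] [[|[|[|[|j]]]] //= hj].
all: by rewrite !permE /= -?val_eqE /= ?inordK.
Qed.

Lemma permutative_mxM x z : permutative (mxM s x z).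
Proof.
apply: permutative_perm_eq => i k; rewrite mxM_mx4 /image_mem !enum_ordSl enum_ord0 /= !mxE /=.
move: i k => [[|[|[|[|i]]]] //= hi] [[|[|[|[|k]]]] //= hk].
(* Every row lists [x], [-x], [z], [w] in some order, so for each predicate [p] the counts are the
   same sum reordered. *)
all: by apply/seq.permP=> p /=; lia.
Qed.

(** Put e = [signr K s], w = e - z and c = x^2 + z^2 - e z. As e^2 = 1, each column has squared norm
    1 + 2c; columns 1, 2 and columns 3, 4 have inner product -2c; all other inner products cancel
    identically. *)
Lemma orthogonal_mxM_circle x z :
  x ^+ 2 + z ^+ 2 - signr K s * z = 0 -> orthogonal_mx (mxM s x z).
Proof.
move=> circ; have e2 : signr K s ^+ 2 = 1 by case: s; rewrite /= ?sqrrN expr1n.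
have x2 : x ^+ 2 = signr K s * z - z ^+ 2.
  by apply/eqP; rewrite -subr_eq0 -[0]circ; apply/eqP; ring.
rewrite mxM_mx4; apply/matrixP=> i j.
rewrite !mxE !big_ord_recl big_ord0 !mxE /=.
move: i j => [[|[|[|[|i]]]] //= hi] [[|[|[|[|j]]]] //= hj].
all: by ring: e2 x2.
Qed.
End Families.

(** * Rational points of the circle *)

Lemma ratr_signr (K : numFieldType) (s : sign) :
  ratr (signr rat s) = signr K s.
Proof. by case: s; rewrite /= ?rmorphN rmorph1. Qed.

Lemma rational_mxM (K : numFieldType) (s : sign) (x z : K) :
  rational_mx (mxM s x z) <-> exists p q : rat, x = ratr p /\ z = ratr q.
Proof.
rewrite mxM_mx4; split=> [ratM | [p [q [-> ->]]] i j].
  have [p] := ratM (inord 0) (inord 0); have [q] := ratM (inord 0) (inord 2).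
  by rewrite !mxE !inordK //= => -> ->; exists p, q.
rewrite -ratr_signr -rmorphB -rmorphN mxE.
move: i j => [[|[|[|[|i]]]] //= hi] [[|[|[|[|j]]]] //= hj]; by eexists.
Qed.

(* Stereographic projection from [X = 1] of the unit circle
   [X ^+ 2 + Y ^+ 2 = 1], where [X = 2 * x] and [Y = 2 * z - e]. *)
Lemma rational_circle (F : realFieldType) (e x z : F) : e ^+ 2 = 1 ->
  x ^+ 2 + z ^+ 2 - e * z = 0 ->
  (exists r : F, x = (r ^+ 2 - 1) / (2 * (r ^+ 2 + 1)) /\
                 z = e / 2 + r / (r ^+ 2 + 1))
  \/ (x = 1 / 2 /\ z = e / 2).
Proof.
(* The centre of projection is split off: at X = 1 the circle equation becomes Y^2 = 0. *)
move=> e2 circ; have [x1 | x1] := eqVneq x (1 / 2).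
  right; split=> //; move: circ; rewrite x1 => circ.
  have /eqP : (z - e / 2) ^+ 2 = 0.
    apply: etrans circ.
    have -> : (1 / 2 : F) ^+ 2 = e ^+ 2 / 4 by rewrite e2; field.
    by field.
  by rewrite expf_eq0 /= subr_eq0 => /eqP.
have d0 : 1 - 2 * x != 0 by apply: contra x1 => /eqP d0; apply/eqP; lra.
(* The parameter is r = Y / (1 - X). Since Y^2 = 1 - X^2, it satisfies r^2 + 1 = 2 / (1 - X), which
   inverts the projection. *)
left; exists ((2 * z - e) / (1 - 2 * x)).
have r2 : ((2 * z - e) / (1 - 2 * x)) ^+ 2 + 1 = 2 / (1 - 2 * x).
  have num : (2 * z - e) ^+ 2 = 1 - 4 * x ^+ 2.
    have -> : x ^+ 2 = e * z - z ^+ 2 by lra.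
    by ring: e2.
  by rewrite expr_div_n num; field.
have -> : ((2 * z - e) / (1 - 2 * x)) ^+ 2 - 1 = 2 / (1 - 2 * x) - 2.
  by rewrite -r2; ring.
by rewrite r2; split; field.
Qed.

(** * The six families *)

Lemma perm_family (K : comNzRingType) (s : sign) (x z : K) (Pbar A : 'M[K]_4) :
  in_one_oplus_P3 Pbar ->
  A \in [:: Pbar *m mxM s x z;
            Pbar *m mxN s z x;
            Pbar *m P23 *m mxM s x z *m P23;
            Pbar *m P23 *m mxN s z x *m P23;
            Pbar *m P24 *m mxM s x z *m P24;
            Pbar *m P24 *m mxN s z x *m P24] ->
  exists u v : 'S_4, A = perm_mx u *m mxM s x z *m perm_mx v.
Proof.
case=> P /is_perm_mxP[t ->] ->.
rewrite -[block_mx _ _ _ _]/(lift0_mx (perm_mx t)) lift0_mx_perm.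
have [u [v ->]] := mxN_mxM _ s x z; rewrite /P23 /P24 !inE !orbA.
have Pmul a b (B : 'M[K]_4) : perm_mx a *m (perm_mx b *m B) = perm_mx (a * b) *m B.
  by rewrite mulmxA -perm_mxM.
move=> inA; do 5?[case/orP: inA => inA]; move: inA => /eqP->;
  rewrite -?mulmxA -?perm_mxM ?Pmul ?mulmxA.
all: try by do 2!eexists.
(* What remains is [Pbar *m mxM s x z], which has no right factor. *)
all: by exists (lift0_perm t), 1%g; rewrite perm_mx1 mulmx1.
Qed.

Theorem corollary2p7 (R : realType) (s : sign) (x z : R[i]) (Pbar A : 'M[R[i]]_4)
    (hplus : s = Plus -> x ^+ 2 + z ^+ 2 - z = 0)
    (hminus : s = Minus -> x ^+ 2 + z ^+ 2 + z = 0)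
    (hP : in_one_oplus_P3 Pbar)
    (hA : A \in [:: Pbar *m mxM s x z;
                    Pbar *m mxN s z x;
                    Pbar *m P23 *m mxM s x z *m P23;
                    Pbar *m P23 *m mxN s z x *m P23;
                    Pbar *m P24 *m mxM s x z *m P24;
                    Pbar *m P24 *m mxN s z x *m P24]) :
  (s = Plus ->
    (rational_mx A /\ orthogonal_mx A /\ permutative A <->
      (exists r : rat,
         x = ratr ((r ^+ 2 - 1) / (2 * (r ^+ 2 + 1))) /\
         (z = ratr (1 / 2 + r / (r ^+ 2 + 1)) \/
          z = ratr (1 / 2 - r / (r ^+ 2 + 1))))
      (* the value r = oo of the parameter *)
      \/ (x = 1 / 2 /\ z = 1 / 2)))
  /\
  (s = Minus ->
    (rational_mx A /\ orthogonal_mx A /\ permutative A <->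
      (exists r : rat,
         x = ratr ((r ^+ 2 - 1) / (2 * (r ^+ 2 + 1))) /\
         (z = ratr (- (1 / 2) + r / (r ^+ 2 + 1)) \/
          z = ratr (- (1 / 2) - r / (r ^+ 2 + 1))))
      \/ (x = 1 / 2 /\ z = - (1 / 2)))).

Proof.
have [u [v defA]] := perm_family _ _ _ _ _ _ hP hA; rewrite {}defA {A hA hP}.
have circ : x ^+ 2 + z ^+ 2 - signr _ s * z = 0.
  by case: s hplus hminus => [/(_ erefl) + _ | _ /(_ erefl)];
    rewrite /= ?mulN1r ?mul1r ?opprK.
have ratA : rational_mx (perm_mx u *m mxM s x z *m perm_mx v) /\
    orthogonal_mx (perm_mx u *m mxM s x z *m perm_mx v) /\
    permutative (perm_mx u *m mxM s x z *m perm_mx v) <->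
    exists p q : rat, x = ratr p /\ z = ratr q.
  rewrite rational_perm_mx rational_mxM; split=> [[] // | ratxz]; split=> //.
  split; last exact/permutative_perm_mx/permutative_mxM.
  apply: orthogonal_mxM; last exact: perm_mx_orthogonal.
  by apply: orthogonal_mxM; [apply: perm_mx_orthogonal | apply: orthogonal_mxM_circle].
(* Injectivity of [ratr] carries the circle equation down to [rat]; parametrizing there makes r
   itself rational. *)
have rational_point (p q : rat) : x = ratr p -> z = ratr q ->
    (exists r : rat, p = (r ^+ 2 - 1) / (2 * (r ^+ 2 + 1)) /\
                     q = signr _ s / 2 + r / (r ^+ 2 + 1))
    \/ (p = 1 / 2 /\ q = signr _ s / 2).
  move=> xp zq; apply: rational_circle; first by case: (s).
  apply: (fmorph_inj (ratr : rat -> R[i])); rewrite rmorph0 -[RHS]circ xp zq.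
  by rewrite rmorphB rmorphD !rmorphXn rmorphM /= ratr_signr.
have half : 1 / 2 = ratr (1 / 2) :> R[i] by rewrite fmorph_div rmorph1 rmorph_nat.
have rational_pointsE : (exists p q : rat, x = ratr p /\ z = ratr q) <->
    (exists r : rat, x = ratr ((r ^+ 2 - 1) / (2 * (r ^+ 2 + 1))) /\
       (z = ratr (signr _ s / 2 + r / (r ^+ 2 + 1)) \/
        z = ratr (signr _ s / 2 - r / (r ^+ 2 + 1))))
    \/ (x = ratr (1 / 2) /\ z = ratr (signr _ s / 2)).
  split=> [[p [q [xp zq]]] | ].
    have [[r [pE qE]] | [pE qE]] := rational_point p q xp zq; rewrite xp zq pE qE.
      (* The plus sign suffices here, because r ranges over both signs. *)
      by left; exists r; split; last left.
    by right.
  by case=> [[r [-> [] ->]] | [-> ->]]; do 2!eexists; split; reflexivity.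
have minus_half : - (1 / 2) = ratr (- 1 / 2) :> R[i].
  by rewrite mulNr rmorphN half.
rewrite ratA rational_pointsE; split=> ->; rewrite /= ?half ?minus_half ?mulNr //.
Qed.
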